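(* Let $f\colon T_1\to T_2$ and $g\colon T_2\to T_3$ be isogenies of complex tori. Then $e(g\circ f)$ divides $e(g)\cdot e(f)$.
   Context: A complex torus of dimension $g$ is a quotient $T=V/L$ of a complex vector space $V$ of dimension $g$ by a lattice $L$ (a discrete subgroup of $V$ of rank $2g$ generating $V$ as a real vector space). A homomorphism of complex tori is a holomorphic group homomorphism. An isogeny is a surjective homomorphism with finite kernel. The exponent $e(f)$ of an isogeny $f$ is the smallest $n\in\mathbb Z_{>0}$ such that $nt=0$ for all $t\in\ker f$. *)

(* Defs.v *)
From HB Require Import structures.
From mathcomp Require Import all_boot all_order all_algebra.
From mathcomp Require Import generic_quotient ring_quotient complex.
From mathcomp Require Import all_classical all_reals all_analysis.

Set Implicit Arguments.
Unset Strict Implicit.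
Unset Printing Implicit Defensive.

Import Order.TTheory GRing.Theory Num.Theory numFieldNormedType.Exports.
Local Open Scope classical_set_scope.
Local Open Scope ring_scope.
Local Open Scope quotient_scope.
Local Open Scope complex_scope.

Definition has_dim (K : fieldType) (V : lmodType K) (g : nat) : Prop :=
  exists e : 'I_g -> V, forall v : V,
    exists! c : 'rV[K]_g, v = \sum_(i < g) c 0 i *: e i.

Definition zindep (V : zmodType) (n : nat) (b : 'I_n -> V) : Prop :=
  forall c : 'I_n -> int, \sum_(i < n) b i *~ c i = 0 -> forall i, c i = 0.

Definition has_rank (V : zmodType) (L : set V) (n : nat) : Prop :=
  (exists b : 'I_n -> V, (forall i, L (b i)) /\ zindep b) /\
  (forall b : 'I_n.+1 -> V, (forall i, L (b i)) -> ~ zindep b).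

Definition real_span (R : realType) (V : lmodType R[i]) (L : set V) : set V :=
  [set v | exists n (c : 'I_n -> R) (l : 'I_n -> V),
     (forall i, L (l i)) /\ v = \sum_(i < n) (c i)%:C *: l i].

(* [L] is a subgroup because it is a [zmodClosed] predicate. *)
Record is_lattice (R : realType) (V : normedModType R[i]) (g : nat)
    (L : zmodClosed V) : Prop := IsLattice {
  lattice_discrete : [set` L] `<=` isolated [set` L];
  lattice_rank : has_rank [set` L] (2 * g);
  lattice_span : real_span [set` L] = setT }.

(* The norm on the finite-dimensional space [torus_space] only serves to give
   access to the library's topology and differentials: all norms on it are
   equivalent, so that neither discreteness nor holomorphy depends on it. *)
Record complexTorus (R : realType) := ComplexTorus {
  torus_dim : nat;
  torus_space : normedModType R[i];
  torus_lattice : zmodClosed torus_space;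
  torus_spaceP : has_dim torus_space torus_dim;
  torus_latticeP : is_lattice torus_dim torus_lattice }.

Definition torus_points (R : realType) (T : complexTorus R) : zmodType :=
  Quotient.quot (torus_lattice T).
Coercion torus_points : complexTorus >-> GRing.Zmodule.type.

Definition torus_proj (R : realType) (T : complexTorus R)
    (v : torus_space T) : T :=
  \pi_(Quotient.quot (torus_lattice T)) v.

(* The inverses of the restrictions of the projection V -> V/L to the open sets
   on which it is injective form the holomorphic atlas of V/L. *)
Definition chart_domain (R : realType) (T : complexTorus R)
    (U : set (torus_space T)) : Prop :=
  open U /\ {in U &, injective (@torus_proj R T)}.

(* Around every point [f] is read in suitable charts (with [f] mapping the
   source chart into the target chart) as a complex differentiable map [h]. *)
Definition holomorphic (R : realType) (T1 T2 : complexTorus R)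
    (f : T1 -> T2) : Prop :=
  forall x : T1, exists (U : set (torus_space T1)) (W : set (torus_space T2))
      (h : torus_space T1 -> torus_space T2),
    [/\ chart_domain U, chart_domain W, (@torus_proj R T1 @` U) x,
        (forall u, U u -> W (h u) /\ torus_proj (h u) = f (torus_proj u))
      & forall u, U u -> differentiable h u].

Record torusHom (R : realType) (T1 T2 : complexTorus R) := TorusHom {
  torusHom_fun :> {additive T1 -> T2};
  torusHom_holomorphic : holomorphic torusHom_fun }.

Definition torus_ker (R : realType) (T1 T2 : complexTorus R)
    (f : torusHom T1 T2) : set T1 := [set t | f t = 0].

Record isogeny (R : realType) (T1 T2 : complexTorus R) := Isogeny {
  isogeny_hom :> torusHom T1 T2;
  isogeny_surj : range isogeny_hom = setT;
  isogeny_finite_ker : finite_set (torus_ker isogeny_hom) }.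

Section Composition.
Variables (R : realType) (T1 T2 T3 : complexTorus R).

Lemma torus_projD (T : complexTorus R) (u v : torus_space T) :
  torus_proj (u + v) = torus_proj u + torus_proj v.
Proof. exact: (raddfD (\pi_(Quotient.quot (torus_lattice T)))). Qed.

Lemma holomorphic_comp (g : T2 -> T3) (f : T1 -> T2) :
  holomorphic g -> holomorphic f -> holomorphic (g \o f).
Proof.
move=> hg hf x.
have [U [W [h [[oU iU] cW [u0 Uu0 pu0] fh dh]]]] := hf x.
have [U' [W' [h' [[oU' iU'] cW' [u1 U'u1 pu1] gh dh']]]] := hg (f x).
pose l := u1 - h u0.
have pD v : torus_proj (v + l) = torus_proj v.
  suff pl : torus_proj l = 0 by rewrite torus_projD pl addr0.
  apply: (addrI (torus_proj (h u0))).
  by rewrite addr0 -torus_projD /l [h u0 + _]addrC subrK pu1 (fh _ Uu0).2 pu0.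
pose k u := h u + l.
have dk u : U u -> differentiable k u.
  by move=> Uu; apply: differentiableD; [exact: dh|exact: differentiable_cst].
have kU u : U u -> torus_proj (k u) = f (torus_proj u).
  by move=> Uu; rewrite /k pD (fh _ Uu).2.
exists (U `&` k @^-1` U'), W', (h' \o k); split => //.
- split; last first.
    by move=> u v /set_mem[Uu _] /set_mem[Uv _]; apply: iU; exact/mem_set.
  rewrite openE => u [Uu U'k].
  apply: filterI; first exact: open_nbhs_nbhs.
  apply: (differentiable_continuous (dk u Uu)).
  exact: open_nbhs_nbhs.
- exists u0 => //; split => //=.
  by rewrite /k /l addrC subrK.
- move=> u [Uu U'k] /=; split; first exact: (gh _ U'k).1.
  by rewrite (gh _ U'k).2 kU.
- move=> u [Uu U'k]; apply: differentiable_comp; first exact: dk.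
  exact: dh'.
Qed.

Definition torusHom_comp (g : torusHom T2 T3) (f : torusHom T1 T2) :
    torusHom T1 T3 :=
  @TorusHom R T1 T3 (g \o f : {additive T1 -> T3})
    (holomorphic_comp (torusHom_holomorphic g) (torusHom_holomorphic f)).

Lemma isogeny_comp_surj (g : isogeny T2 T3) (f : isogeny T1 T2) :
  range (torusHom_comp g f) = setT.
Proof.
apply/seteqP; split=> // z _.
have : range g z by rewrite isogeny_surj.
case=> y _ <-; have : range f y by rewrite isogeny_surj.
by case=> x _ <-; exists x.
Qed.

Lemma isogeny_comp_finite_ker (g : isogeny T2 T3) (f : isogeny T1 T2) :
  finite_set (torus_ker (torusHom_comp g f)).
Proof.
have lift (y : T2) : exists x, f x = y.
  have : range f y by rewrite isogeny_surj.
  by case=> x _ <-; exists x.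
pose s (y : T2) : T1 := sval (cid (lift y)).
have fs y : f (s y) = y by rewrite /s; case: cid.
apply: (@sub_finite_set _ _
  [set (x.1 + s x.2 : T1) | x in torus_ker f `*` torus_ker g]).
  move=> t /= gft; exists (t - s (f t), f t) => /=; last by rewrite subrK.
  by split => //=; rewrite /torus_ker /= raddfB fs subrr.
apply: finite_image; apply: finite_setX; exact: isogeny_finite_ker.
Qed.

Definition isogeny_comp (g : isogeny T2 T3) (f : isogeny T1 T2) :
    isogeny T1 T3 :=
  Isogeny (isogeny_comp_surj g f) (isogeny_comp_finite_ker g f).

End Composition.

Section Exponent.
Variables (R : realType) (T1 T2 : complexTorus R) (f : isogeny T1 T2).

Definition annihilates_ker : pred nat :=
  fun n => `[< (0 < n)%N /\ forall t, torus_ker f t -> t *+ n = 0 >].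

Lemma annihilates_ker_ex : exists n, annihilates_ker n.
Proof.
have /finite_seqP[s sE] := isogeny_finite_ker f.
have ord (t : T1) : torus_ker f t -> exists n, (0 < n)%N /\ t *+ n = 0.
  move=> ft; apply: contrapT => /forallNP nt.
  suff : (size [seq t *+ n | n <- iota 0 (size s).+1] <= size s)%N.
    by rewrite size_map size_iota ltnn.
  apply: uniq_leq_size => [|_ /mapP[n _ ->]]; last first.
    suff : torus_ker f (t *+ n) by rewrite sE.
    by rewrite /torus_ker /= raddfMn ft mul0rn.
  have lt_neq m n : (m < n)%N -> t *+ m <> t *+ n.
    move=> mn tmn; apply: (nt (n - m)%N); split; first by rewrite subn_gt0.
    apply: (addrI (t *+ m)).
    by rewrite -mulrnDr (subnKC (ltnW mn)) addr0.
  rewrite map_inj_uniq ?iota_uniq // => m n tmn.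
  by case: (ltngtP m n) => // /lt_neq; rewrite tmn.
have : forall t, t \in s -> exists n, (0 < n)%N /\ t *+ n = 0.
  by move=> t ts; apply: ord; rewrite sE.
suff : (forall t, t \in s -> exists n, (0 < n)%N /\ t *+ n = 0) ->
    exists n, (0 < n)%N /\ forall t, t \in s -> t *+ n = 0.
  by move=> /[apply] -[n [n0 sn]]; exists n; apply/asboolP; split=> // t;
     rewrite sE; exact: sn.
elim: s {sE} => [|t s IH] ex; first by exists 1%N.
have [|n [n0 sn]] := IH; first by move=> u us; apply: ex; rewrite inE us orbT.
have [|m [m0 tm]] := ex t; first by rewrite inE eqxx.
exists (m * n)%N; rewrite muln_gt0 m0 n0; split=> // u.
rewrite inE => /predU1P[->|us]; first by rewrite mulrnA tm mul0rn.
by rewrite mulnC mulrnA sn // mul0rn.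
Qed.

Definition exponent : nat := ex_minn annihilates_ker_ex.

End Exponent.

(* Main.v *)
Require Import Defs.
From mathcomp Require Import all_boot all_order all_algebra.
From mathcomp Require Import all_classical all_reals all_analysis.

(** If [t] lies in the kernel of [g \o f], then [f t] lies in the kernel of [g],
    so [e(g) * t] lies in the kernel of [f] and is annihilated by [e(f)]; hence
    [e(g) * e(f)] annihilates the kernel of [g \o f].  The integers that
    annihilate a kernel form an ideal, whose least positive element divides all
    the others ([dvdn_exponent]). *)

Import GRing.Theory.
Local Open Scope ring_scope.

Lemma exponent_gt0 (R : realType) (T1 T2 : complexTorus R)
    (f : isogeny T1 T2) : (0 < exponent f)%N.
Proof. by rewrite /exponent; case: ex_minnP => n /asboolP[]. Qed.

Lemma exponent_annihilates (R : realType) (T1 T2 : complexTorus R)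
    (f : isogeny T1 T2) (t : T1) : f t = 0 -> t *+ exponent f = 0.
Proof. by rewrite /exponent; case: ex_minnP => n /asboolP[_ +] _; apply. Qed.

(** The remainder of [n] modulo the exponent still annihilates the kernel and
    is smaller than the exponent, so minimality forces it to vanish. *)
Lemma dvdn_exponent (R : realType) (T1 T2 : complexTorus R)
    (f : isogeny T1 T2) (n : nat) :
  (forall t : T1, f t = 0 -> t *+ n = 0) -> (exponent f %| n)%N.
Proof.
move=> kern; rewrite /dvdn -leqn0 leqNgt; apply/negP => r_gt0.
have : (n %% exponent f < exponent f)%N by rewrite ltn_mod exponent_gt0.
rewrite ltnNge => /negP; apply.
rewrite {1}/exponent; case: ex_minnP => e _; apply.
apply/asboolP; split=> // t ft0; have := kern t ft0.
rewrite {1}(divn_eq n (exponent f)) mulrnDr mulnC mulrnA.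
by rewrite exponent_annihilates // mul0rn add0r.
Qed.

Theorem corollary10 (R : realType) (T1 T2 T3 : complexTorus R)
    (f : isogeny T1 T2) (g : isogeny T2 T3) :
  (exponent (isogeny_comp g f) %| exponent g * exponent f)%N.
Proof.
apply: dvdn_exponent => t gft0; rewrite mulrnA.
by apply: exponent_annihilates; rewrite raddfMn; apply: exponent_annihilates.
Qed.
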